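(* For every integer $n\ge 0$, $$P_{2n}(x)=\sum_{0\le 2k\le n}\frac{n!\,(-2^{1/3})^{n-2k}}{(n-2k)!\,k!}\,\mathrm{Pi}_{n-2k}\Bigl(-\frac{x}{2^{1/3}}\Bigr)P_k(x),\qquad Q_{2n}(x)=\sum_{0\le 2k\le n}\frac{n!\,(-2^{1/3})^{n-2k}}{(n-2k)!\,k!}\,\mathrm{Pi}_{n-2k}\Bigl(-\frac{x}{2^{1/3}}\Bigr)Q_k(x).$$
   Context: $\mathrm{Ai},\mathrm{Bi}$ are the Airy functions, which satisfy $y''=xy$. The polynomials $P_n,Q_n$ ($n\ge0$; the index is the order of the derivative, not the degree) are defined by $\mathrm{Ai}^{(n)}(x)=P_n(x)\mathrm{Ai}(x)+Q_n(x)\mathrm{Ai}'(x)$ and $\mathrm{Bi}^{(n)}(x)=P_n(x)\mathrm{Bi}(x)+Q_n(x)\mathrm{Bi}'(x)$; for instance $P_0=1$, $Q_0=0$, $P_1=0$, $Q_1=1$, $P_2=x$, $Q_2=0$. The Airy polynomials $\mathrm{Pi}_n$ are defined by the generating function $\sum_{n\ge0}\mathrm{Pi}_n(x)\frac{t^n}{n!}=\exp\bigl(xt-\frac{t^3}{3}\bigr)$. *)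

(* Defs.v *)
From mathcomp Require Import all_boot all_order all_algebra.
From mathcomp Require Import all_classical all_reals all_analysis.

Set Implicit Arguments.
Unset Strict Implicit.
Unset Printing Implicit Defensive.

Import Order.TTheory GRing.Theory Num.Theory.
Import numFieldNormedType.Exports.

Local Open Scope classical_set_scope.
Local Open Scope ring_scope.

(* Improper integral of [f] over [0, +oo[, as the limit of the integrals over
   [0, T]. It has to be taken in this sense because the Airy integrals below
   converge only conditionally, hence are not Lebesgue integrals over
   [0, +oo[. *)
Definition improper_integral (R : realType) (f : R -> R) : R :=
  lim ((\int[@lebesgue_measure R]_(t in `[0, T]) f t)%R @[T --> +oo]).

(* The Airy functions of a real variable, by their classical integral
   representations. *)
Definition Ai (R : realType) (x : R) : R :=
  pi^-1 * improper_integral (fun t : R => cos (t ^+ 3 / 3 + x * t)).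

Definition Bi (R : realType) (x : R) : R :=
  pi^-1 * improper_integral
    (fun t : R => expR (- (t ^+ 3 / 3) + x * t) + sin (t ^+ 3 / 3 + x * t)).

(* The two equations for all [n] and all real [x] determine [P] and [Q]
   uniquely. *)
Definition airy_derivative_polys (R : realType) (P Q : nat -> {poly R}) : Prop :=
  forall (n : nat) (x : R),
    derive1n n (@Ai R) x = (P n).[x] * Ai x + (Q n).[x] * derive1 (@Ai R) x /\
    derive1n n (@Bi R) x = (P n).[x] * Bi x + (Q n).[x] * derive1 (@Bi R) x.

(* The generating series is entire in [t], so the generating function identity
   is stated as convergence of the series at every real [t]. *)
Definition airy_polys (R : realType) (Pi : nat -> {poly R}) : Prop :=
  forall x t : R,
    [series (Pi n).[x] * (t ^+ n / n`!%:R)]_n @ \oo --> expR (x * t - t ^+ 3 / 3).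

Definition cbrt2 (R : realType) : R := 2 `^ (3^-1).

(* Main.v *)
Require Import Defs.
From mathcomp Require Import all_boot all_order all_algebra ssrAC.
From mathcomp Require Import all_classical all_reals all_analysis.
From mathcomp Require Import ring lra zify.

Set Implicit Arguments.
Unset Strict Implicit.
Unset Printing Implicit Defensive.

Import Order.TTheory GRing.Theory Num.Theory.
Import numFieldNormedType.Exports.

(** The integral [airy_int x T] of [cos (t^3/3 + xt)] over [0, T], corrected by
    [- sin (T^3/3 + xT) / T^2], satisfies [y'' = x y] in [x] up to a forcing term
    [O(1/T^2)]. Since its value and derivative at [x = 0] converge as [T] grows,
    Gronwall's inequality identifies the limit with a power series solution of
    Airy's equation, whose value at [0] is positive. Hence [Ai'' = x Ai].
    As Airy's equation has no rational Riccati solution, [Ai] alone determines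
    [P] and [Q]: the pair [(P n, Q n)] is [airy_deriv^n (1, 0)].

    The identity is the coefficient of [s^n/n!] in
      [exp (s D^2) y = exp (x s + 2 s^3/3) * y (x + s^2)],
    where the exponential generates the polynomials [(-c)^m Pi_m (-x/c)],
    [c^3 = 2]. It is checked by showing that the two sides satisfy the same
    recursion [S_(n+1) = D^2 S_n]. *)

Local Open Scope classical_set_scope.
Local Open Scope ring_scope.

(** * The algebraic identity *)

Section HeatShift.
Variables (R : numFieldType) (V : lmodType {poly R}).
Variables (D : V -> V) (e : V) (a : nat -> {poly R}).
Hypothesis D_add : {morph D : u v / u + v}.
Hypothesis D_scale : forall p v, D (p *: v) = p^`() *: v + p *: D v.
Hypothesis DDe : D (D e) = 'X *: e.
(** These relations say that [G = \sum_m a m * s^m] solves [dG/ds = (X + 2 s^2) G], that is,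
    [G = exp (X s + 2 s^3/3)]. *)
Hypothesis a0 : a 0%N = 1.
Hypothesis a1 : a 1%N = 'X.
Hypothesis a2 : 2%:R * a 2%N = 'X * a 1%N.
Hypothesis aS : forall m, m.+3%:R * a m.+3 = 'X * a m.+2 + 2%:R * a m.

(* [ah j] is [a (j - 3)] for integer indices, [a] being 0 at negative ones, so
   that the recursion below holds without exceptions. *)
Let ah (j : nat) : {poly R} := if j is j'.+3 then a j' else 0.

(** For [j <= 2] the truncated factor on the left is 0, and so is the right side; the initial values
    enter from [j = 3] on. *)
Let ah_rec j : (j - 2)%N%:R * ah j.+1 = 'X * ah j + 2%:R * ah (j - 2).
Proof.
case: j => [|[|[|[|[|[|j]]]]]] //=; rewrite ?mul0r ?mulr0 ?addr0 ?mul1r //.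
- by rewrite a1 a0 mulr1.
- exact: aS.
- exact: aS.
Qed.

Let natp_neq0 m : (m.+1%:R : {poly R}) != 0.
Proof. by rewrite -polyC_natr polyC_eq0 pnatr_eq0. Qed.

(** This is [dG/dx = s G], coefficient by coefficient. The induction is strong because the recursion
    reaches back three indices. *)
Let deriv_ah_pair j : (forall i, (i <= j)%N -> (ah i)^`() = ah i.-1).
Proof.
elim: j => [|j IH] i; first by rewrite leqn0 => /eqP ->; rewrite deriv0.
rewrite leq_eqVlt ltnS => /orP[/eqP -> /=|]; last exact: IH.
case: j IH => [|[|[|j]]] IH; rewrite /= ?deriv0 //.
  by rewrite a0 -polyC1 derivC.
(* This gives [(j+1) * (ah j.+4)' = ah j.+3 + X * ah j.+2 + 2 * ah j]. The last two terms are
   [j * ah j.+3], so [j+1] cancels. *)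
have := congr1 deriv (ah_rec j.+3).
rewrite derivD !derivM derivX mul1r -!polyC_natr !derivC !mul0r !add0r.
rewrite !polyC_natr (IH j.+3) // (IH (j.+3 - 2)%N) ?leq_subr //.
have -> : ((j.+3 - 2).-1 = j.+2 - 2)%N by rewrite !subn2.
rewrite -addrA (_ : j.+3.-1 = j.+2) // -(ah_rec j.+2) !subSS !subn0.
by rewrite -{1}[ah j.+3]mul1r -mulrDl nat1r => /(mulfI (natp_neq0 j)).
Qed.

Let deriv_ah j : (ah j)^`() = ah j.-1.
Proof. exact: (@deriv_ah_pair j). Qed.

Let D0 : D 0 = 0.
Proof. by apply: (addrI (D 0)); rewrite -D_add !addr0. Qed.

Let D_sum N (F : 'I_N -> V) : D (\sum_(k < N) F k) = \sum_(k < N) D (F k).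
Proof. exact: (big_morph D D_add D0). Qed.

Let Dn k := iter k D e.

(** Leibniz' rule for ['X *: e]. At [k = 0] the factor [k%:R] cancels the default value of
    [k.-1]. *)
Let DnSS k : Dn k.+2 = 'X *: Dn k + k%:R *: Dn k.-1.
Proof.
elim: k => [|k IH]; first by rewrite scale0r addr0 [LHS]DDe.
rewrite -[LHS]/(D (Dn k.+2)) IH D_add !D_scale derivX scale1r.
rewrite -polyC_natr derivC scale0r add0r polyC_natr addrC addrA addrC.
congr (_ + _); case: k {IH} => [|k] /=.
  by rewrite scale0r add0r scale1r.
by rewrite -[X in _ + X]scale1r -scalerDl natr1.
Qed.

(** The coefficient of [s^(2k)] in the expansion of [y (x + s^2)], with [e] in the role of [y]. *)
Let z k := (k`!%:R^-1)%:P *: Dn k.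

Let D_z k : D (z k) = k.+1%:R *: z k.+1.
Proof.
rewrite /z D_scale derivC scale0r add0r scalerA -polyC_natr -polyCM.
rewrite factS natrM invfM mulrA divff ?mul1r // pnatr_eq0 //.
Qed.

(** The coefficient of [h^k] in [y'' (x + h) = (x + h) * y (x + h)]. *)
Let DD_z k : D (D (z k)) = 'X *: z k + (if k is k'.+1 then z k' else 0).
Proof.
rewrite D_z /z !D_scale -polyC_natr !derivC !scale0r !add0r.
rewrite scalerA -polyCM factS natrM invfM mulrA divff ?pnatr_eq0 // mul1r.
rewrite -[D (Dn _)]/(Dn k.+2) DnSS scalerDr !scalerA [_ * 'X]mulrC.
congr (_ + _); case: k => [|k] /=; first by rewrite mulr0 scale0r.
rewrite -polyC_natr -polyCM factS natrM invfM mulrAC mulVf ?pnatr_eq0 //.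
by rewrite mul1r.
Qed.

(** With [Y = y (x + s^2)], both [d/ds] and [D^2] send [G Y] to [(x + 2 s^2) G Y + 2 s G Y']. A
    fixed [N] keeps the same summation range throughout the induction; the terms with [2k > n] are
    0. *)
Lemma iter_double_derivation N n : (n < N)%N ->
  iter n (D \o D) e =
  n`!%:R *: \sum_(k < N) (if (2 * k <= n)%N then a (n - 2 * k) else 0) *:
     ((k`!%:R^-1)%:P *: iter k D e).
Proof.
move=> nN.
have -> : \sum_(k < N) (if (2 * k <= n)%N then a (n - 2 * k)%N else 0) *:
     ((k`!%:R^-1)%:P *: iter k D e) = \sum_(k < N) ah (n.+3 - 2 * k) *: z k.
  apply: eq_bigr => k _; congr (_ *: _); rewrite /ah.
  case: leqP => kn; first by rewrite !subSn // ?leqW // ltnW.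
  by case E: (n.+3 - 2 * k)%N => [|[|[|m]]] //; exfalso; move: E kn; lia.
elim: n nN => [|n IH] nN.
  rewrite scale1r; case: N nN => // N _; rewrite big_ord_recl /=.
  rewrite a0 scale1r /z invr1 polyC1 scale1r big1 ?addr0 // => i _.
  by rewrite /bump /= mulnDr (_ : ah _ = 0) ?scale0r // subnDA; case: (2 * i)%N.
rewrite [LHS]/= {}IH ?(ltnW nN) //.
rewrite !D_scale -polyC_natr derivC !scale0r !add0r D_scale derivC scale0r add0r.
rewrite polyC_natr factS mulnC natrM -scalerA; congr (_ *: _).
rewrite !D_sum scaler_sumr.
(* [U] and [W] are the coefficients of [s^n] in [s^2 G Y] and in [2 s G Y']. *)
pose U := \sum_(k < N) ah (n.+1 - 2 * k) *: z k.
pose W := \sum_(k < N) (2 * k.+1)%:R *: (ah (n.+2 - 2 * k) *: z k.+1).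
transitivity ('X *: \sum_(k < N) ah (n.+3 - 2 * k) *: z k + 2%:R *: U + W).
  have -> : 2%:R *: U = U + U by rewrite scaler_nat mulr2n.
  (* One copy of [U] comes from the second derivative of [ah], the other from the term [z k'] of
     [DD_z] after an index shift. The term lost at the top has an index of [ah] below 3, hence is
     0. *)
  have {2}-> : U = \sum_(k < N) ah (n.+3 - 2 * k) *:
       (if nat_of_ord k is k'.+1 then z k' else 0).
    case: N nN @U @W => // N nN U W.
    rewrite /U big_ord_recr big_ord_recl /= scaler0 add0r.
    rewrite (_ : ah (n.+1 - _) = 0); last first.
      by case E: (n.+1 - 2 * N)%N => [|[|[|m]]] //; exfalso; move: E nN; lia.
    rewrite scale0r addr0; apply: eq_bigr => k _.
    by rewrite /bump /=; congr (ah _ *: _); lia.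
  rewrite /W /U scaler_sumr -!big_split /=; apply: eq_bigr => k _.
  rewrite (D_scale (ah _)) deriv_ah D_add !(D_scale (ah _)) !deriv_ah DD_z D_z.
  rewrite (_ : (n.+3 - 2 * k).-1.-1 = n.+1 - 2 * k)%N; last lia.
  rewrite (_ : (n.+3 - 2 * k).-1 = n.+2 - 2 * k)%N; last lia.
  move: (ah _) (ah _) (ah _) (z k) (z k.+1)
    (if nat_of_ord k is k'.+1 then z k' else 0) => r q p t s w.
  rewrite scalerDr [r *: ('X *: t)]scalerA [r * _]mulrC -scalerA.
  have -> : (2 * k.+1)%:R *: (q *: s) = q *: (k.+1%:R *: s) + q *: (k.+1%:R *: s).
    by rewrite natrM -scalerA scaler_nat mulr2n !scalerA [q * _]mulrC.
  by rewrite [LHS](AC (2*(1*2)) ((4*(1*5))*(2*3))).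
have -> : W = \sum_(k < N) (2 * k)%:R *: (ah (n.+4 - 2 * k) *: z k).
  rewrite /W; case: N nN @U @W => // N nN U W.
  rewrite big_ord_recr [RHS]big_ord_recl /= muln0 scale0r add0r.
  rewrite (_ : ah (n.+2 - 2 * N) = 0); last first.
    by case E: (n.+2 - 2 * N)%N => [|[|[|m]]] //; exfalso; move: E nN; lia.
  rewrite scale0r scaler0 addr0; apply: eq_bigr => k _.
  by rewrite /bump /= add1n; congr (_ *: (ah _ *: _)); lia.
rewrite /U !scaler_sumr -!big_split /=; apply: eq_bigr => k _.
move: (z k) => t; rewrite !scalerA -!scalerDl; congr (_ *: _).
have -> : (n.+1 - 2 * k = n.+3 - 2 * k - 2)%N by lia.
rewrite -ah_rec.
(* For [2k <= n+1] the factors [n+1-2k] and [2k] add up to [n+1]. Beyond that [ah (n.+4 - 2 * k)] is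
   0; the case [2k > n+3] is apart because truncated subtraction no longer commutes with the
   successor there. *)
have [kn|kn] := leqP (2 * k)%N n.+3.
  rewrite -subSn // -mulrDl; case: (leqP (2 * k)%N n.+1) => kn'.
    by rewrite -natrD; congr (_%:R * _); lia.
  rewrite (_ : ah (n.+4 - 2 * k) = 0) ?mulr0 //.
  by case E: (n.+4 - 2 * k)%N => [|[|[|m]]] //; exfalso; move: E kn'; lia.
have -> : (n.+4 - 2 * k = 0)%N by lia.
have -> : (n.+3 - 2 * k = 0)%N by lia.
by rewrite /= !mulr0 addr0.
Qed.

End HeatShift.

(* A pair [(p, q)] stands for [p * y + q * y'] with [y'' = 'X * y], and
   [airy_deriv] for its derivative. *)
Definition airy_deriv (R : nzRingType) (v : {poly R} * {poly R}) :=
  (v.1^`() + 'X * v.2, v.1 + v.2^`()).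

Definition airy_pair (R : nzRingType) n := iter n (@airy_deriv R) (1, 0).

(** Putting [t = - c s] in the generating function at [- x / c] gives [exp (x s + c^3 s^3/3)], which
    is [G] since [c^3 = 2]. This explains the choice of [a] below. *)
Lemma airy_pair_even (R : numFieldType) (Pi : nat -> {poly R}) (c : R) n x :
  c ^+ 3 = 2 -> Pi 0%N = 1 -> Pi 1%N = 'X -> Pi 2%N = 'X * Pi 1%N ->
  (forall m, Pi m.+3 = 'X * Pi m.+2 - (m.+2 * m.+1)%:R * Pi m) ->
  let coef k := (n`!%:R * (- c) ^+ (n - 2 * k) / ((n - 2 * k)`!%:R * k`!%:R)) *
    (Pi (n - 2 * k)%N).[- (x / c)] in
  (airy_pair R (2 * n)).1.[x] =
    \sum_(0 <= k < n.+1 | (2 * k <= n)%N) coef k * (airy_pair R k).1.[x] /\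
  (airy_pair R (2 * n)).2.[x] =
    \sum_(0 <= k < n.+1 | (2 * k <= n)%N) coef k * (airy_pair R k).2.[x].
Proof.
move=> c3 Pi0 Pi1 Pi2 PiS coef.
have c0 : c != 0.
  by apply/eqP => c0; move/eqP: c3; rewrite c0 expr0n /= eq_sym pnatr_eq0.
pose V : lmodType {poly R} := ({poly R}^o * {poly R}^o)%type.
pose D : V -> V := @airy_deriv R.
pose e : V := (1, 0).
pose a m : {poly R} :=
  (m`!%:R^-1 * (- c) ^+ m)%:P * (Pi m \Po ((- c^-1) *: 'X)).
have aE m :
  a m = (m`!%:R^-1 * (- c) ^+ m)%:P * (Pi m \Po ((- c^-1) *: 'X)) by [].
have D_add : {morph D : u v / u + v}.
  by move=> [u1 u2] [v1 v2]; congr (_, _); rewrite /= derivD; ring.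
have D_scale p v : D (p *: v) = p^`() *: v + p *: D v.
  case: v => v1 v2; congr (_, _); rewrite /= /GRing.scale /= derivM; ring.
have DDe : D (D e) = 'X *: e.
  rewrite /D /e /airy_deriv /=; congr (_, _); rewrite /GRing.scale /=.
    by rewrite !(derivC, deriv0, mulr0, addr0, add0r).
  by rewrite !(derivC, deriv0, mulr0, addr0, add0r).
have a0 : a 0%N = 1 by rewrite /a Pi0 comp_polyC !mulr1 invr1 polyC1.
have a1 : a 1%N = 'X.
  rewrite /a Pi1 comp_polyX invr1 mul1r expr1 -mul_polyC mulrA -polyCM mulrNN.
  by rewrite divff // polyC1 mul1r.
have lin m : (m.+1%:R : {poly R}) * ((m.+1)`!%:R^-1 * (- c) ^+ m.+1)%:P =
   (m`!%:R^-1 * (- c) ^+ m)%:P * (- c)%:P.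
  rewrite -polyC_natr -!polyCM; congr (_%:P).
  rewrite factS natrM invfM exprS !mulrA divff ?pnatr_eq0 // mul1r.
  by rewrite -!mulrA mulrN mulNr [c * _]mulrC.
have lX : (- c)%:P * ((- c^-1) *: 'X) = 'X :> {poly R}.
  by rewrite -mul_polyC mulrA -polyCM mulrNN divff // polyC1 mul1r.
have a2 : 2%:R * a 2%N = 'X * a 1%N.
  rewrite aE mulrA lin Pi2 comp_polyM comp_polyX mulrA -[_ * _ * (_ *: 'X)]mulrA lX.
  by rewrite /a; ring.
have aS m : m.+3%:R * a m.+3 = 'X * a m.+2 + 2%:R * a m.
  (* Here [c^3 = 2] turns the term [- (m+2)(m+1) Pi_m] of the recursion into [2 * a m]. *)
  have coefE : - ((m.+2)`!%:R^-1 * (- c) ^+ m.+2 * (- c) * (m.+2 * m.+1)%:R) =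
      2%:R * (m`!%:R^-1 * (- c) ^+ m) :> R.
    rewrite -c3 !factS !natrM !(exprS _ m.+1) !(exprS _ m).
    move: (fact_gt0 m); rewrite lt0n -(pnatr_eq0 R).
    move: (m`!%:R) ((- c) ^+ m) => f g f0.
    by field; rewrite f0 /= nat1r -natrD !pnatr_eq0.
  rewrite aE mulrA lin PiS comp_polyB !comp_polyM comp_polyX mulrBr mulrA.
  rewrite -[_ * _ * (_ *: 'X)]mulrA lX; congr (_ + _); first by rewrite aE; ring.
  rewrite rmorph_nat aE [RHS]mulrA -[2%:R in RHS]polyC_natr -[in RHS]polyCM -coefE.
  move: ((m.+2)`!%:R^-1 * (- c) ^+ m.+2) => u.
  by rewrite [in RHS]polyCN !polyCM polyC_natr; ring.
have H := @iter_double_derivation R V D e a D_add D_scale DDe a0 a1 a2 aS n.+1 n (ltnSn n).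
have {H} H : airy_pair R (2 * n) = \sum_(k < n.+1)
    n`!%:R *: ((if (2 * k <= n)%N then a (n - 2 * k)%N else 0) *:
     ((k`!%:R^-1)%:P *: (airy_pair R k : V))) :> V.
  by rewrite -scaler_sumr -[RHS]H mulnC /airy_pair iterM.
(* Stated for any linear [f], so that it applies to both projections. *)
have eval (f : V -> {poly R}) : {morph f : u v / u + v} ->
    (forall p u, f (p *: u) = p * f u) ->
    (f (airy_pair R (2 * n))).[x] =
      \sum_(0 <= k < n.+1 | (2 * k <= n)%N) coef k * (f (airy_pair R k)).[x].
  move=> f_add f_scale; rewrite H.
  have f0 : f 0 = 0 by rewrite -(scale0r (0 : V)) f_scale mul0r.
  rewrite (big_morph f f_add f0) horner_sum big_mkord [RHS]big_mkcond /=.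
  apply: eq_bigr => k _; rewrite !f_scale.
  case: ifP => [_|]; last by rewrite mul0r mulr0 hornerC.
  rewrite aE -polyC_natr !hornerM !hornerC horner_comp hornerZ hornerX /coef.
  rewrite mulNr [c^-1 * x]mulrC invfM !mulrA; congr (_ * _).
  by rewrite [n`!%:R / _ * _]mulrAC [RHS]mulrAC.
by split; [apply: (eval fst) | apply: (eval snd)].
Qed.

(* A relation [a y + b y' = 0] and its derivative give this equation. The terms
   [a^2] and ['X b^2] have degrees of different parity, and the two terms with a
   derivative have a smaller degree than one of them. *)
Lemma airy_riccati (R : idomainType) (a b : {poly R}) :
  a * (a + b^`()) = b * (a^`() + 'X * b) -> a = 0 /\ b = 0.
Proof.
move=> E.
have [b0|b0] := eqVneq b 0.
  by move/eqP: E; rewrite b0 mul0r deriv0 addr0 mulf_eq0 orbb => /eqP.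
have a0 : a != 0.
  apply: contra_neq b0 => a0; move/eqP: E.
  by rewrite a0 mul0r deriv0 add0r eq_sym !mulf_eq0 polyX_eq0 /= orbb => /eqP.
have E2 : a * a + a * b^`() - b * a^`() = 'X * (b * b) by rewrite -mulrDr E; ring.
have sa2 : size (a * a) = (size a + size a).-1 by rewrite size_mul.
have sb2 : size ('X * (b * b)) = (size b + size b)%N.
  rewrite mulrC size_mulX ?mulf_neq0 // size_mul // prednK //.
  by rewrite addn_gt0 size_poly_gt0 b0.
have da : (size a^`() < size a)%N by apply: lt_size_deriv.
have db : (size b^`() < size b)%N by apply: lt_size_deriv.
have sa : (0 < size a)%N by rewrite size_poly_gt0.
have sb : (0 < size b)%N by rewrite size_poly_gt0.
have s1 : (size (a * b^`())%R < (size a + size b).-1)%N.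
  by apply: leq_ltn_trans (size_polyMleq _ _) _; lia.
have s2 : (size (b * a^`())%R < (size a + size b).-1)%N.
  by apply: leq_ltn_trans (size_polyMleq _ _) _; lia.
have s3 : (size (a * b^`() - b * a^`())%R < (size a + size b).-1)%N.
  by apply: leq_ltn_trans (size_polyD _ _) _; rewrite size_polyN gtn_max s1 s2.
exfalso; move: E2; rewrite -addrA => E2.
have [ba|ab] := ltnP (size b) (size a).
  have : size (a * a + (a * b^`() - b * a^`())) = (size a + size a).-1.
    by rewrite size_polyDl // sa2; lia.
  by rewrite E2 sb2; lia.
have : (size (a * a + (a * b^`() - b * a^`()))%R < size b + size b)%N.
  apply: leq_ltn_trans (size_polyD _ _) _; rewrite gtn_max sa2; lia.
by rewrite E2 sb2 ltnn.
Qed.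

(** * Everywhere convergent power series *)

Section EntireSeries.
Variable R : realType.
Implicit Types (c : R^nat) (x t r : R).

Definition entire_coef c := forall t, cvgn (pseries c t).

(** The bound on the terms is easier to carry over to the differentiated series than convergence
    itself. *)
Lemma entire_coefP c : entire_coef c <->
  (forall r, 0 < r -> exists M, forall n, `|c n| * r ^+ n <= M).
Proof.
split=> [Ec r r0|bc t].
  have [K [Kreal Kf]] := cvg_series_bounded (Ec r).
  exists (K + 1) => n.
  have := Kf (K + 1) _ n; rewrite ltrDl ltr01 => /(_ isT I).
  by rewrite /= normrM normrX (ger0_norm (ltW r0)).
(* Then [|t| / r <= 1/2], and a geometric series dominates. *)
pose r := 2%:R * `|t| + 1.
have r0 : 0 < r by rewrite /r ltr_wpDl // mulr_ge0.
have [M cM] := bc r r0.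
have M0 : 0 <= M by apply: le_trans (cM 0%N); rewrite mulr_ge0 // exprn_ge0 // ltW.
apply: normed_cvg.
apply: (@series_le_cvg _ _ (geometric M (2^-1))).
- by move=> n /=.
- by move=> n /=; rewrite mulr_ge0 // exprn_ge0 // invr_ge0.
- move=> n /=; rewrite normrM normrX.
  have -> : `|c n| * `|t| ^+ n = `|c n| * r ^+ n * (`|t| / r) ^+ n.
    by rewrite -mulrA -exprMn [r * _]mulrC divfK ?gt_eqF.
  apply: ler_pM => //.
  - by rewrite mulr_ge0 // exprn_ge0 // ltW.
  - by rewrite exprn_ge0 // divr_ge0 // ltW.
  - rewrite lerXn2r ?nnegrE ?divr_ge0 ?invr_ge0 ?(ltW r0) //.
    by rewrite ler_pdivrMr // /r; lra.
by apply: is_cvg_geometric_series; rewrite ger0_norm ?invr_ge0 //; lra.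
Qed.

Lemma entire_coef_diffs c : entire_coef c -> entire_coef (pseries_diffs c).
Proof.
move=> /entire_coefP bc; apply/entire_coefP => r r0.
(* Since [n+1 <= 2^(n+1)], doubling the radius absorbs the factor from differentiation; the quotient
   [M / r] accounts for the index shift. *)
have [M cM] := bc (2%:R * r) (mulr_gt0 (ltr0Sn _ 1) r0).
exists (M / r) => n; rewrite ler_pdivlMr // /pseries_diffs normrM -mulrA -exprSr.
apply: le_trans (cM n.+1); rewrite [`|_%:R|]normr_nat exprMn mulrA.
rewrite [n.+1%:R * _]mulrC -!mulrA ler_wpM2l // ler_wpM2r ?exprn_ge0 ?(ltW r0) //.
by rewrite -natrX ler_nat ltnW // ltn_expl.
Qed.

Lemma is_derive_entire c x : entire_coef c ->
  is_derive x 1 (fun t => limn (pseries c t)) (limn (pseries (pseries_diffs c) x)).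
Proof.
move=> Ec; have Ec1 := entire_coef_diffs Ec; have Ec2 := entire_coef_diffs Ec1.
apply: (@pseries_snd_diffs _ _ (`|x| + 1)) => //.
by rewrite [ltRHS]ger0_norm ?addr_ge0 // ltrDl ltr01.
Qed.

Lemma lim_pseries0 c : limn (pseries c 0) = c 0%N.
Proof.
apply/cvg_lim => //; rewrite -cvg_shiftS.
rewrite (_ : (fun n => _) = (fun=> c 0%N)); first exact: cvg_cst.
apply/funext => n; rewrite /pseries /series /= big_nat_recl // expr0 mulr1.
by rewrite big1 ?addr0 // => i _; rewrite expr0n /= mulr0.
Qed.

(** The value at 0 is the constant term; for the other coefficients the induction passes to the
    derivative, which is again identically 0. *)
Lemma entire_eq0 c : entire_coef c -> (forall t, limn (pseries c t) = 0) ->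
  forall n, c n = 0.
Proof.
move=> Ec c0 n; elim: n c Ec c0 => [|n IH] c Ec c0.
  by rewrite -lim_pseries0 c0.
have := IH _ (entire_coef_diffs Ec) _; rewrite /pseries_diffs => H.
have : n.+1%:R * c n.+1 = 0.
  apply: H => t; have [_ <-] := is_derive_entire t Ec.
  by under eq_fun do rewrite c0; rewrite derive_cst.
by move/eqP; rewrite mulf_eq0 pnatr_eq0 /= => /eqP.
Qed.

End EntireSeries.

(** * Power series solutions of Airy's equation *)

Section AirySeries.
Variables (R : realType) (a b : R).
Implicit Types x : R.

(** From [y'' = x y]: [c_2 = 0] and [(m+3)(m+2) c_(m+3) = c_m], with [y 0 = a] and [y' 0 = b]. *)
Fixpoint airy_coef (n : nat) : R :=
  match n with
  | 0 => a
  | 1 => b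
  | 2 => 0
  | m.+3 => airy_coef m / (m.+3 * m.+2)%:R
  end.

Lemma entire_airy_coef : entire_coef airy_coef.
Proof.
apply/entire_coefP => r r0.
pose u n := `|airy_coef n| * r ^+ n.
have u0 n : 0 <= u n by rewrite mulr_ge0 // exprn_ge0 // ltW.
pose N := Num.truncn (r ^+ 3).
(* [u n.+3] is [u n * r^3 / ((n+3)(n+2))], and [r^3 < N+1 <= n+3]. *)
have uN n : (N < n.+3)%N -> u n.+3 <= u n.
  have e3 : r ^+ n.+3 = r ^+ n * r ^+ 3 by rewrite -exprD addn3.
  move=> Nn; rewrite /u -[airy_coef n.+3]/(airy_coef n / (n.+3 * n.+2)%:R).
  rewrite normrM -mulrA ler_wpM2l // normfV normr_nat.
  rewrite mulrC ler_pdivrMr ?ltr0n // e3 ler_wpM2l ?exprn_ge0 ?(ltW r0) //.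
  apply: le_trans (ltW (truncnS_gt _)) _; rewrite ler_nat.
  apply: leq_trans Nn _. by rewrite leq_pmulr.
(* Steps of three lead from any index down to the first [N+3] terms, each bounded by their sum. *)
exists (\sum_(i < N.+3) u i) => n; rewrite -/(u n).
elim/ltn_ind: n => n IH.
have [nN|Nn] := ltnP n N.+3.
  by rewrite (bigD1 (Ordinal nN)) //= lerDl sumr_ge0.
case: n IH Nn => [|[|[|n]]] // IH Nn.
by apply: le_trans (uN n _) (IH n _) => //; rewrite -ltnS ltnW // ltnW.
Qed.

Definition airy_sol x : R := limn (pseries airy_coef x).
Definition airy_sol' x : R := limn (pseries (pseries_diffs airy_coef) x).

Lemma is_derive_airy_sol x : is_derive x 1 airy_sol (airy_sol' x).
Proof. exact: is_derive_entire entire_airy_coef. Qed.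

Lemma is_derive_airy_sol' x : is_derive x 1 airy_sol' (x * airy_sol x).
Proof.
have Ec := entire_airy_coef; have Ec1 := entire_coef_diffs Ec.
rewrite -[x * _](_ : limn (pseries (pseries_diffs (pseries_diffs airy_coef)) x) = _).
  exact: is_derive_entire Ec1.
(* The constant coefficient of the second derivative is [2 c_2 = 0]; dropping it exposes the factor
   [x]. *)
apply/cvg_lim => //; rewrite -cvg_shiftS.
rewrite (_ : (fun n => _) = (fun n => x * pseries airy_coef x n)).
  exact: cvgMr (Ec x).
apply/funext => n; rewrite /pseries /series /= big_nat_recl //.
rewrite {1}/pseries_diffs /pseries_diffs /=.
rewrite !mulr0 mul0r add0r mulr_sumr; apply: eq_bigr => i _.
rewrite exprS natrM; field.
by rewrite -!natrD !pnatr_eq0.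
Qed.

Lemma airy_sol_0 : airy_sol 0 = a.
Proof. exact: lim_pseries0. Qed.

Lemma airy_sol'_0 : airy_sol' 0 = b.
Proof. by rewrite /airy_sol' lim_pseries0 /pseries_diffs mul1r. Qed.

End AirySeries.

(** * Gronwall estimate and monotone limits *)

Section RealCalculus.
Variable R : realType.
Implicit Types (f df g : R -> R) (a b x : R).

Lemma is_derive_continuous f (df x : R) : is_derive x 1 f df -> {for x, continuous f}.
Proof. by case=> /derivable1_diffP/differentiable_continuous. Qed.

Lemma ge0_is_derive_le f df a b : a <= b ->
  (forall x, a <= x <= b -> is_derive x 1 f (df x)) ->
  (forall x, a <= x <= b -> 0 <= df x) -> f a <= f b.
Proof.
move=> ab Hf Hdf.
have [| |c cab E] := @MVT_segment R f df a b ab.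
- move=> x; rewrite in_itv /= => /andP[ax xb].
  by apply: Hf; rewrite !ltW.
- apply: derivable_within_continuous => x; rewrite in_itv /= => xab.
  by have [] := Hf x xab.
rewrite -subr_ge0 E mulr_ge0 ?subr_ge0 //; apply: Hdf.
by move: cab; rewrite in_itv.
Qed.

Lemma is_derive_cos_comp g x dg : is_derive x 1 g dg ->
  is_derive x 1 (fun s => cos (g s)) (- sin (g x) * dg).
Proof. by move=> gx; exact: (@is_derive1_comp _ cos g). Qed.

Lemma is_derive_sin_comp g x dg : is_derive x 1 g dg ->
  is_derive x 1 (fun s => sin (g s)) (cos (g x) * dg).
Proof. by move=> gx; exact: (@is_derive1_comp _ sin g). Qed.

Lemma is_derive_expR_comp g x dg : is_derive x 1 g dg ->
  is_derive x 1 (fun s => expR (g s)) (expR (g x) * dg).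
Proof. by move=> gx; exact: (@is_derive1_comp _ expR g). Qed.

Lemma is_derive_inv_pow n x : x != 0 ->
  is_derive x 1 (fun s : R => s ^- n) (- n%:R * x ^- n.+1).
Proof.
move=> x0.
have xn0 : x ^+ n != 0 by rewrite expf_neq0.
have H : is_derive x 1 (fun s : R => s ^+ n) (n%:R * x ^+ n.-1).
  have := @is_deriveX _ _ (fun s : R => s) n x 1 1 (is_derive_id _ _).
  rewrite exprfctE /GRing.scale /= mulr1; exact.
have [dH vH] := H; split; first exact: derivableV.
rewrite (@deriveV _ _ (fun s : R => s ^+ n)) // vH /GRing.scale /=.
case: n {H dH vH} xn0 => [|n] xn0; first by rewrite !mul0r mulr0 oppr0 mul0r.
by rewrite /= !exprS; field; rewrite x0 expf_neq0.
Qed.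

End RealCalculus.

#[export] Existing Instances is_derive_cos_comp is_derive_sin_comp
  is_derive_expR_comp.

Section Gronwall.
Variable R : realType.

(** The energy [E = u^2 + v^2] satisfies [E' <= (X + 2) E + e^2]: [2uv] contributes at most [E],
    [2quv] at most [X E], and [2vr] at most [E + e^2]. Hence [phi] is nondecreasing. *)
Let gronwall_right (u v q r : R -> R) (X e x : R) :
  (forall s : R, is_derive s 1 u (v s)) ->
  (forall s : R, is_derive s 1 v (q s * u s + r s)) ->
  (forall s, 0 <= s <= x -> `|q s| <= X) ->
  (forall s, 0 <= s <= x -> `|r s| <= e) ->
  0 <= x ->
  u x ^+ 2 <= (u 0 ^+ 2 + v 0 ^+ 2 + e ^+ 2 * x) * expR ((X + 2) * x).
Proof.
move=> du dv qX re x0.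
pose K := X + 2.
pose E s := u s ^+ 2 + v s ^+ 2.
pose phi s := e ^+ 2 * s - E s * expR (- K * s).
pose dphi s := e ^+ 2 - ((2 * u s * v s + 2 * v s * (q s * u s + r s)) * expR (- K * s)
                 + E s * (expR (- K * s) * - K)).
have : phi 0 <= phi x.
  apply: (@ge0_is_derive_le _ phi dphi) => // s /andP[s0 sx].
    rewrite /phi /E; apply: is_derive_eq; rewrite /GRing.scale /= /dphi /E; ring.
  rewrite /dphi /E.
  have qs : `|q s| <= X by apply: qX; rewrite s0.
  have rs : `|r s| <= e by apply: re; rewrite s0.
  have X0 : 0 <= X by apply: le_trans qs.
  have ex1 : expR (- K * s) <= 1.
    by rewrite -expR0 ler_expR mulNr oppr_le0 mulr_ge0 // /K addr_ge0.
  have ex0 : 0 <= expR (- K * s) by exact: expR_ge0.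
  move: (expR _) ex0 ex1 => ex ex0 ex1.
  have rr : r s ^+ 2 <= e ^+ 2.
    by rewrite -real_normK ?num_real // lerXn2r ?nnegrE // (le_trans _ rs).
  have quv : 2 * v s * (q s * u s) <= X * (u s ^+ 2 + v s ^+ 2).
    apply: le_trans (ler_norm _) _.
    rewrite (_ : 2 * v s * (q s * u s) = q s * (2 * u s * v s)); last by ring.
    rewrite normrM; apply: ler_pM => //; rewrite ler_norml.
    by apply/andP; split; [have := sqr_ge0 (u s + v s)|have := sqr_ge0 (u s - v s)];
      rewrite ?sqrrD ?sqrrB; lra.
  have uv : 2 * u s * v s <= u s ^+ 2 + v s ^+ 2.
    by have := sqr_ge0 (u s - v s); rewrite sqrrB; lra.
  have vr : 2 * v s * r s <= v s ^+ 2 + r s ^+ 2.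
    by have := sqr_ge0 (v s - r s); rewrite sqrrB; lra.
  have u2 := sqr_ge0 (u s).
  have e2 := sqr_ge0 e.
  rewrite subr_ge0 (_ : _ + _ = ex * (2 * u s * v s + 2 * v s * (q s * u s) +
    2 * v s * r s - K * (u s ^+ 2 + v s ^+ 2))); last by ring.
  apply: (@le_trans _ _ (ex * e ^+ 2)); last by rewrite ler_piMl.
  by apply: ler_wpM2l => //; rewrite /K; lra.
rewrite /phi /E !mulr0 expR0 mulr1 sub0r => H.
have exp0 := expR_gt0 (- K * x).
have -> : expR ((X + 2) * x) = (expR (- K * x))^-1 by rewrite mulNr expRN invrK.
rewrite ler_pdivlMr //.
have : 0 <= v x ^+ 2 * expR (- K * x) by rewrite mulr_ge0 ?sqr_ge0 // ltW.
by move: H; rewrite mulrDl; lra.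
Qed.

Lemma gronwall (u v q r : R -> R) (X e x : R) :
  (forall s : R, is_derive s 1 u (v s)) ->
  (forall s : R, is_derive s 1 v (q s * u s + r s)) ->
  (forall s, `|s| <= `|x| -> `|q s| <= X) ->
  (forall s, `|s| <= `|x| -> `|r s| <= e) ->
  u x ^+ 2 <= (u 0 ^+ 2 + v 0 ^+ 2 + e ^+ 2 * `|x|) * expR ((X + 2) * `|x|).
Proof.
move=> du dv qX re; have [x0|x0] := leP 0 x.
  rewrite ger0_norm //; apply: (gronwall_right du dv) => // s /andP[s0 sx].
    by apply: qX; rewrite !ger0_norm // (le_trans s0).
  by apply: re; rewrite !ger0_norm // (le_trans s0).
have nx0 : 0 <= - x by rewrite oppr_ge0 ltW.
rewrite ltr0_norm //.
(* Reflecting [s] and changing the sign of [v] preserves the form of the system. *)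
have := @gronwall_right (fun s => u (- s)) (fun s => - v (- s))
   (fun s => q (- s)) (fun s => r (- s)) X e (- x).
rewrite /= oppr0 opprK sqrrN; apply => //.
- move=> s; have := @is_derive1_comp _ u -%R s _ _ (du (- s)) (is_deriveNid _ _).
  by rewrite mulrN1.
- move=> s; have := @is_derive1_comp _ v -%R s _ _ (dv (- s)) (is_deriveNid _ _).
  by move=> H; apply: is_derive_eq; rewrite mulrN1 opprK.
- by move=> s /andP[s0 sx]; apply: qX; rewrite normrN ger0_norm // ltr0_norm.
- by move=> s /andP[s0 sx]; apply: re; rewrite normrN ger0_norm // ltr0_norm.
Qed.

End Gronwall.

Section MonotoneLimit.
Variable R : realType.

(** As [h + C / x] is nonincreasing, the nondecreasing [h] stays below [h 1 + C]. The bound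
    [h 1 <= l] serves to show that the Airy integral at 0 is positive. *)
Lemma cvg_of_derive_bound (h dh : R -> R) (C : R) :
  (forall x : R, 1 <= x -> is_derive x 1 h (dh x)) ->
  (forall x : R, 1 <= x -> 0 <= dh x <= C * x ^- 2) ->
  exists2 l, h x @[x --> +oo] --> l & h 1 <= l.
Proof.
move=> hd hb.
(* Constant to the left of 1, hence monotone on the whole line. *)
pose g (x : R) := h (Num.max 1 x).
have hle x y : 1 <= x -> x <= y -> h x <= h y.
  move=> x1 xy; apply: (@ge0_is_derive_le _ h dh) => // z /andP[xz zy].
    by apply: hd; apply: le_trans xz.
  by have /andP[] := hb z (le_trans x1 xz).
have C0 : 0 <= C.
  by have /andP[H1 H2] := hb 1 (lexx _); move: (le_trans H1 H2); rewrite expr1n invr1 mulr1.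
have hub x : 1 <= x -> h x <= h 1 + C.
  move=> x1.
  have : - (h 1 + C * 1 ^- 1) <= - (h x + C * x ^- 1).
    apply: (@ge0_is_derive_le _ (fun s => - (h s + C * s ^- 1))
       (fun s => - (dh s + C * (- 1%:R * s ^- 2)))) => // z /andP[z1 zx].
      have dhz := hd z z1.
      have z0 : z != 0 by rewrite gt_eqF // (lt_le_trans ltr01).
      have dz := is_derive_inv_pow 1 z0.
      by apply: is_derive_eq; rewrite /GRing.scale /=; ring.
    by have /andP[_] := hb z z1; lra.
  rewrite invr1 mulr1 lerN2 => H; apply: le_trans H; rewrite lerDl.
  by rewrite mulr_ge0 // invr_ge0 exprn_ge0 // (le_trans ler01).
have max1 (x : R) : 1 <= Num.max 1 x by rewrite le_max lexx.
have gnd : nondecreasing_fun g.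
  by move=> x y xy; apply: hle => //; rewrite ge_max max1 le_max xy orbT.
have gub : has_ubound (range g).
  by exists (h 1 + C) => _ [x _ <-]; exact: hub.
exists (sup (range g)).
  apply: cvg_trans (nondecreasing_cvgr gnd gub); apply: near_eq_cvg.
  near=> x; rewrite /g max_r //.
by apply: ub_le_sup => //; exists 1 => //; rewrite /g max_l.
Unshelve. all: by end_near. Qed.

End MonotoneLimit.

(** * Recursion for the Airy polynomials *)

Lemma poly_ext (R : numFieldType) (p q : {poly R}) :
  (forall x, p.[x] = q.[x]) -> p = q.
Proof.
move=> pq; apply/eqP; rewrite -subr_eq0; apply/eqP.
apply: (@roots_geq_poly_eq0 _ _ [seq i%:R | i <- iota 0 (size (p - q))]).
- by apply/allP => x _; rewrite /root hornerD hornerN pq subrr.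
- by rewrite map_inj_uniq ?iota_uniq // => i j /eqP; rewrite eqr_nat => /eqP.
- by rewrite size_map size_iota.
Qed.

Section AiryPolyRec.
Variables (R : realType) (Pi : nat -> {poly R}).
Hypothesis hPi : airy_polys Pi.

Let c (x : R) : R^nat := fun n => (Pi n).[x] / n`!%:R.

Let c_cvg x t : pseries (c x) t @ \oo --> expR (x * t - t ^+ 3 / 3).
Proof.
have := @hPi x t; rewrite (_ : pseries _ _ = [series (Pi n).[x] * (t ^+ n / n`!%:R)]_n) //.
by congr series; apply/funext => n; rewrite /c /= mulrAC mulrA.
Qed.

Let c_entire x : entire_coef (c x).
Proof. by move=> t; apply/cvg_ex; eexists; exact: c_cvg. Qed.

Let c_lim x t : limn (pseries (c x) t) = expR (x * t - t ^+ 3 / 3).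
Proof. by apply/cvg_lim => //; exact: c_cvg. Qed.

Let dc_lim x t : limn (pseries (pseries_diffs (c x)) t) =
  (x - t ^+ 2) * expR (x * t - t ^+ 3 / 3).
Proof.
have [_ <-] := is_derive_entire t (@c_entire x).
under eq_fun do rewrite c_lim.
have H : is_derive t 1 (fun s : R => x * s - s ^+ 3 / 3) (x - t ^+ 2).
  apply: is_derive_eq; rewrite /GRing.scale /=; by field.
by have [_ ->] := is_derive_expR_comp H; rewrite mulrC.
Qed.

(** The coefficients of [g' - x g + t^2 g] for [g = exp (x t - t^3/3)]; they vanish because
    [g' = (x - t^2) g]. *)
Let d x : R^nat := fun n => pseries_diffs (c x) n - x * c x n +
  (if n is m.+2 then c x m else 0).

Let d_cvg x t : pseries (d x) t @ \oo --> (0 : R).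
Proof.
pose E := expR (x * t - t ^+ 3 / 3).
have -> : 0 = (x - t ^+ 2) * E - x * E + t ^+ 2 * E :> R by ring.
have -> : pseries (d x) t = (fun n => pseries (pseries_diffs (c x)) t n -
   x * pseries (c x) t n +
   series (fun n => (if n is m.+2 then c x m else 0) * t ^+ n) n).
  apply/funext => n; rewrite /pseries /series /= mulr_sumr -sumrB -big_split /=.
  by apply: eq_bigr => i _; rewrite /d !mulrDl mulNr mulrA.
apply: cvgD; first apply: cvgB.
- by rewrite /E -dc_lim; exact: (entire_coef_diffs (@c_entire x)).
- by apply: cvgMr; exact: c_cvg.
(* The first two coefficients of [t^2 g] are 0; the partial sums shifted by two are [t^2] times
   those of [g]. *)
rewrite -(cvg_shiftn 2) /=.
rewrite (_ : (fun n => _) = (fun n => t ^+ 2 * pseries (c x) t n)).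
  by apply: cvgMr; exact: c_cvg.
apply/funext => n; rewrite addn2 /series /= !big_nat_recl // !mul0r !add0r.
by rewrite /pseries /series /= mulr_sumr; apply: eq_bigr => i _; rewrite !exprS; ring.
Qed.

Let d0 x n : d x n = 0.
Proof.
apply: entire_eq0 => t; last by apply/cvg_lim => //; exact: d_cvg.
by apply/cvg_ex; eexists; exact: d_cvg.
Qed.

Lemma airy_poly0 : Pi 0%N = 1.
Proof.
apply: poly_ext => x; rewrite hornerC; have := lim_pseries0 (c x).
by rewrite c_lim /c divr1 mulr0 expr0n /= mul0r subrr expR0.
Qed.

(** This is [d0] multiplied by [n!]; for [n = m+2] the quotient [n! / m!] is [(m+2)(m+1)]. *)
Let Pi_rec n x : (Pi n.+1).[x] =
  x * (Pi n).[x] - (if n is m.+2 then (m.+2 * m.+1)%:R * (Pi m).[x] else 0).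
Proof.
have := d0 x n; rewrite /d /pseries_diffs /c.
have f0 : n`!%:R != 0 :> R by rewrite pnatr_eq0 -lt0n fact_gt0.
have -> : n.+1%:R * ((Pi n.+1).[x] / n.+1`!%:R) = (Pi n.+1).[x] / n`!%:R.
  by rewrite factS natrM; field; rewrite f0 /= nat1r pnatr_eq0.
case: n f0 => [|[|m]] f0 H.
- by move: H; rewrite !divr1 addr0 subr0 => /eqP; rewrite subr_eq0 => /eqP.
- by move: H; rewrite !divr1 addr0 subr0 => /eqP; rewrite subr_eq0 => /eqP.
apply: (mulIf (invr_neq0 f0)); apply/eqP; rewrite -subr_eq0 -[X in _ == X]H.
apply/eqP; rewrite !factS !natrM; field.
by rewrite !nat1r -!natrD !pnatr_eq0 -lt0n fact_gt0.
Qed.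

Lemma airy_poly1 : Pi 1%N = 'X.
Proof. by apply: poly_ext => x; rewrite Pi_rec airy_poly0 hornerC hornerX mulr1 subr0. Qed.

Lemma airy_poly2 : Pi 2%N = 'X * Pi 1%N.
Proof. by apply: poly_ext => x; rewrite Pi_rec subr0 hornerM hornerX. Qed.

Lemma airy_polySSS m : Pi m.+3 = 'X * Pi m.+2 - (m.+2 * m.+1)%:R * Pi m.
Proof.
apply: poly_ext => x; rewrite Pi_rec hornerD hornerN !hornerM hornerX.
by rewrite -[(_%:R : {poly R})]polyC_natr hornerC.
Qed.

End AiryPolyRec.

(** * The Airy integral *)

Section SegmentIntegral.
Variable R : realType.
Local Notation mu := (@lebesgue_measure R).
Local Notation int f T := (\int[mu]_(t in `[0, T]) f t)%R.
Implicit Types (f : R -> R) (T : R).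

Lemma integrable_segment f T : continuous f ->
  mu.-integrable `[0, T] (EFin \o f).
Proof.
move=> cf; apply: continuous_compact_integrable; first exact: segment_compact.
exact: continuous_subspaceT.
Qed.

Lemma is_derive_segment_integral f T : continuous f -> 0 < T ->
  is_derive T 1 (fun S => int f S) (f T).
Proof.
move=> cf T0.
have T1 : T < T + 1 by rewrite ltrDl ltr01.
have [dF vF] := continuous_FTC1_closed T1 (integrable_segment _ cf) T0 (cf T).
by split; [exact: dF|rewrite -derive1E vF].
Qed.

Lemma segment_integralE f (F : R -> R) T : continuous f -> 0 < T ->
  (forall t : R, is_derive t 1 F (f t)) -> int f T = F T - F 0.
Proof.
move=> cf T0 dF.
have cF : continuous F by move=> t; exact: is_derive_continuous (dF t).
rewrite /Rintegral (@continuous_FTC2 _ f F) //.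
- exact: continuous_subspaceT.
- split.
  + by move=> t _; have [] := dF t.
  + exact: cvg_at_right_filter (cF 0).
  + exact: cvg_at_left_filter (cF T).
- by move=> t _; have [_] := dF t; rewrite derive1E.
Qed.

(** Differentiation under the integral sign, dominated by the constant [M] while [x] is within 1 of
    [a]. *)
Lemma is_derive_integral_param (f df : R -> R -> R) (M a T : R) :
  (forall x, continuous (f x)) ->
  (forall x t : R, is_derive x 1 (f ^~ t) (df x t)) ->
  (forall x t, a - 1 < x < a + 1 -> 0 <= t <= T -> `|df x t| <= M) ->
  0 <= M ->
  is_derive a 1 (fun x => int (f x) T) (int (df a) T).
Proof.
move=> cf dff bf M0.
have ain : `](a - 1), (a + 1)[%classic a.
  by rewrite /= in_itv /=; apply/andP; split; lra.
have mB : measurable (`[0, T] : set R) by [].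
have dE x t : partial1of2 f x t = df x t.
  by rewrite partial1of2E; have [] := dff x t.
pose I : set R := `](a - 1), (a + 1)[%classic.
have H1 x : I x -> mu.-integrable `[0, T] (EFin \o f x).
  by move=> _; exact: integrable_segment.
have H2 x t : I x -> `[0, T]%classic t -> derivable (f ^~ t) x 1.
  by move=> _ _; have [] := dff x t.
have H3 : mu.-integrable `[0, T] (EFin \o cst M).
  by apply: integrable_segment; exact: cst_continuous.
have H4 x t : I x -> `[0, T]%classic t -> `|partial1of2 f x t| <= cst M t.
  by rewrite /I /= !in_itv /= dE; exact: bf.
have dF := @derivable_under_integral R _ _ mu f _ mB a _ _ ain H1 H2
  (cst M) (fun=> M0) H3 H4.
have vF := @differentiation_under_integral R _ _ mu f _ mB a _ _ ain H1 H2
  (cst M) (fun=> M0) H3 H4.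
split; first exact: dF.
rewrite -derive1E vF; apply: eq_Rintegral => t _.
exact: dE.
Qed.

End SegmentIntegral.

(** * Convergence of the integral of [cos (t^3/3 + xt)] *)

Section AiryIntegral.
Variable R : realType.
Local Notation mu := (@lebesgue_measure R).
Local Notation int f T := (\int[mu]_(t in `[0, T]) f t)%R.
Implicit Types x t T u : R.

Let phi x t := t ^+ 3 / 3 + x * t.

Let dphi_t x t : is_derive t 1 (phi x) (t ^+ 2 + x).
Proof. by apply: is_derive_eq; rewrite /GRing.scale /=; field. Qed.

Let dphi_x x t : is_derive x 1 (phi ^~ t) t.
Proof. by apply: is_derive_eq; rewrite /GRing.scale /=; field. Qed.

Definition airy_int x T := int (fun t : R => cos (t ^+ 3 / 3 + x * t)) T.

Let F' x T := int (fun t : R => - (t * sin (phi x t))) T.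

Let cont_cos x : continuous (fun t => cos (phi x t)).
Proof. by move=> t; exact: is_derive_continuous (is_derive_cos_comp (dphi_t x t)). Qed.

Let cont_sin x : continuous (fun t => sin (phi x t)).
Proof. by move=> t; exact: is_derive_continuous (is_derive_sin_comp (dphi_t x t)). Qed.

Let cont_tsin x : continuous (fun t => - (t * sin (phi x t))).
Proof. by move=> t; apply: cvgN; apply: cvgM => //; exact: cont_sin. Qed.

Let dF x T : 0 < T -> is_derive x 1 (airy_int ^~ T) (F' x T).
Proof.
move=> T0; apply: (@is_derive_integral_param _ (fun x t => cos (phi x t))
   (fun x t => - (t * sin (phi x t))) T) => //; last exact: ltW.
- move=> y t; have H := is_derive_cos_comp (dphi_x y t).
  by apply: is_derive_eq; rewrite mulNr mulrC.
- move=> y t _ /andP[t0 tT]; rewrite normrN normrM ger0_norm // -[leRHS]mulr1.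
  by apply: ler_pM => //; exact: sin_max.
Qed.

(** Pointwise, [- t^2 cos phi = x cos phi - d/dt (sin phi)], and the last term integrates to its
    boundary value. *)
Let dF' x T : 0 < T -> is_derive x 1 (F' ^~ T) (x * airy_int x T - sin (phi x T)).
Proof.
move=> T0.
suff -> : x * airy_int x T - sin (phi x T) = int (fun t => - (t ^+ 2 * cos (phi x t))) T.
  apply: (@is_derive_integral_param _ (fun x t => - (t * sin (phi x t)))
   (fun x t => - (t ^+ 2 * cos (phi x t))) (T ^+ 2)) => //; last exact: sqr_ge0.
  - move=> y t; have H := is_derive_sin_comp (dphi_x y t).
    by apply: is_derive_eq; rewrite /GRing.scale /=; ring.
  - move=> y t _ /andP[t0 tT]; rewrite normrN normrM ger0_norm ?sqr_ge0 // -[leRHS]mulr1.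
    apply: ler_pM; rewrite ?sqr_ge0 ?normr_ge0 ?cos_max //.
    by rewrite lerXn2r // nnegrE ltW.
rewrite /airy_int -RintegralZl //; last first.
  by apply: integrable_segment; exact: cont_cos.
have -> : sin (phi x T) = int (fun t => (t ^+ 2 + x) * cos (phi x t)) T.
  have H t : is_derive t 1 (fun t => sin (phi x t)) ((t ^+ 2 + x) * cos (phi x t)).
    by rewrite mulrC; exact: is_derive_sin_comp.
  rewrite (segment_integralE _ T0 H).
    by rewrite {3}/phi expr0n /= mul0r mulr0 addr0 sin0 subr0.
  move=> t; apply: cvgM; last exact: cont_cos.
  by apply: cvgD; [exact: exprn_continuous|exact: cvg_cst].
rewrite -RintegralB //; last 2 first.
- by apply: integrable_segment => t; apply: cvgMr; exact: cont_cos.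
- apply: integrable_segment => t; apply: cvgM; last exact: cont_cos.
  by apply: cvgD; [exact: exprn_continuous|exact: cvg_cst].
by apply: eq_Rintegral => t _; rewrite /phi; ring.
Qed.

Let inv_cvg0 n : (fun T => T ^- n.+1) @ +oo --> (0 : R).
Proof.
apply/cvgrPdist_le => e e0; near=> T.
have T1 : 1 <= T by near: T; apply: nbhs_pinfty_ge; rewrite num_real.
have Te : e^-1 <= T by near: T; apply: nbhs_pinfty_ge; rewrite num_real.
have T0 : 0 < T by apply: lt_le_trans T1.
rewrite sub0r normrN ger0_norm ?invr_ge0 ?exprn_ge0 ?(ltW T0) //.
apply: (@le_trans _ _ T^-1).
  rewrite lef_pV2 ?posrE ?exprn_gt0 // exprS ler_peMr ?(ltW T0) //.
  exact: exprn_ege1.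
by rewrite invf_ple ?posrE.
Unshelve. all: by end_near. Qed.

Let cvg0_le (f g : R -> R) : (forall T, 1 <= T -> `|f T| <= g T) ->
  g @ +oo --> (0 : R) -> f @ +oo --> (0 : R).
Proof.
move=> fg g0; apply/norm_cvg0P.
apply: (@squeeze_cvgr _ _ _ _ (cst 0) g) => //; last exact: cvg_cst.
near=> T; rewrite /= normr_ge0 /=; apply: fg.
by near: T; apply: nbhs_pinfty_ge; rewrite num_real.
Unshelve. all: by end_near. Qed.

Let sin_le u : 0 <= u -> sin u <= u.
Proof.
move=> u0; rewrite -subr_ge0.
have := @ge0_is_derive_le _ (fun s => s - sin s) (fun s => 1 - cos s) 0 u u0.
rewrite sin0 subr0; apply; last by move=> s _; rewrite subr_ge0 cos_le1.
Qed.

Let cos_ge u : 0 <= u -> 1 - cos u <= u ^+ 2 / 2.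
Proof.
move=> u0; rewrite -subr_ge0.
have := @ge0_is_derive_le _ (fun s => s ^+ 2 / 2 - (1 - cos s)) (fun s => s - sin s) 0 u u0.
rewrite cos0 subrr subr0 expr0n /= mul0r; apply.
  by move=> s _; apply: is_derive_eq; rewrite /GRing.scale /=; field.
by move=> s /andP[s0 _]; rewrite subr_ge0 sin_le.
Qed.

Let phi0 T : phi 0 T = T ^+ 3 / 3.
Proof. by rewrite /phi mul0r addr0. Qed.

(* [airy_int 0 T] after two integrations by parts, without the boundary terms:
   the derivative [dH] is nonnegative. *)
Let H T := airy_int 0 T - sin (phi 0 T) * T ^- 2 - 2 * (1 - cos (phi 0 T)) * T ^- 5.

Let dH T := 10 * (1 - cos (phi 0 T)) * T ^- 6.

Let is_derive_H T : 0 < T -> is_derive T 1 H (dH T).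
Proof.
move=> T0; have Tn0 : T != 0 by rewrite gt_eqF.
have d0 := is_derive_segment_integral (@cont_cos 0) T0.
have d1 := is_derive_sin_comp (dphi_t 0 T).
have d2 := is_derive_cos_comp (dphi_t 0 T).
have d3 := is_derive_inv_pow 2 Tn0.
have d5 := is_derive_inv_pow 5 Tn0.
apply: is_derive_eq; rewrite /GRing.scale /= /dH.
by field.
Qed.

Let dH_ge0 T : 0 <= T -> 0 <= dH T.
Proof.
by move=> T0; rewrite /dH !mulr_ge0 ?invr_ge0 ?exprn_ge0 ?subr_ge0 ?cos_le1.
Qed.

(** This controls [H] near 0, where its formula is singular. Since [phi 0 T = T^3/3], the three
    terms are bounded by [T], [T/3] and [T/9], in total less than [2T]. *)
Let H_lower T : 0 < T -> - (2 * T) <= H T.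
Proof.
move=> T0; rewrite /H.
have h0 : `|airy_int 0 T| <= T.
  apply: le_trans (le_normr_Rintegral _ (integrable_segment _ (@cont_cos 0))) _ => //.
  apply: le_trans (@le_Rintegral _ _ _ _ _ _ (cst 1) _ _ _ _) _ => //.
  - by apply: integrable_segment => t; apply: cvg_norm; exact: cont_cos.
  - by apply: integrable_segment; exact: cst_continuous.
  - by move=> t _; exact: cos_max.
  by rewrite Rintegral_cst //= lebesgue_measure_itv /= lte_fin T0 /= subr0 mul1r.
have p0 : 0 <= phi 0 T by rewrite phi0 divr_ge0 // exprn_ge0 // ltW.
have h1 : sin (phi 0 T) * T ^- 2 <= T / 3.
  rewrite ler_pdivrMr ?exprn_gt0 //; apply: le_trans (sin_le p0) _.
  by rewrite phi0 le_eqVlt; apply/orP; left; apply/eqP; field.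
have h2 : 2 * (1 - cos (phi 0 T)) * T ^- 5 <= T / 9.
  rewrite ler_pdivrMr ?exprn_gt0 // mulrC -ler_pdivlMr //.
  apply: le_trans (cos_ge p0) _.
  by rewrite phi0 le_eqVlt; apply/orP; left; apply/eqP; field.
by move: h0; rewrite ler_norml => /andP[h0 _]; lra.
Qed.

Let H_nd s t : 0 < s -> s <= t -> H s <= H t.
Proof.
move=> s0 st; apply: (ge0_is_derive_le st (df := dH)) => z /andP[sz _].
  by apply: is_derive_H; exact: lt_le_trans sz.
by apply: dH_ge0; apply: le_trans sz; exact: ltW.
Qed.

Let H_ge0 s : 0 < s -> 0 <= H s.
Proof.
move=> s0; rewrite leNgt; apply/negP => Hs.
(* At this [t] the lower bound gives [H t >= H s / 2 > H s], against monotonicity. *)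
pose t := Num.min s (- H s / 4).
have t0 : 0 < t by rewrite lt_min s0 /= divr_gt0 // oppr_gt0.
have ts : t <= s by rewrite ge_min lexx.
have tH : t <= - H s / 4 by rewrite ge_min lexx orbT.
have := H_lower t0; have := H_nd t0 ts; lra.
Qed.

(** The mean value theorem on [[1/2, 1]] gives strictness: there [phi 0] lies in []0, 2[], so the
    sine is positive and the cosine is not 1. *)
Let H1_gt0 : 0 < H 1.
Proof.
have h01 : (1 / 2 : R) < 1 by lra.
have [| |c] := @MVT R H dH (1 / 2) 1 h01.
- by move=> z; rewrite in_itv /= => /andP[z1 _]; apply: is_derive_H; lra.
- apply: derivable_within_continuous => z; rewrite in_itv /= => /andP[z1 _].
  by have [|] := @is_derive_H z; first lra.
rewrite in_itv /= => /andP[c1 c2] E.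
have : 0 < dH c.
  have c0 : 0 < c by lra.
  rewrite /dH divr_gt0 ?exprn_gt0 // mulr_gt0 // subr_gt0.
  have p02 : 0 < phi 0 c < 2.
    rewrite phi0 divr_gt0 ?exprn_gt0 //= ltr_pdivrMr //.
    have : c ^+ 3 <= 1 by rewrite exprn_ile1 // ltW.
    lra.
  have := sin2_gt0 p02; have := cos2Dsin2 (phi 0 c); have := cos_le1 (phi 0 c).
  rewrite le_eqVlt => /orP[/eqP -> |//].
  rewrite expr1n => /eqP; rewrite addrC eq_sym -subr_eq subrr eq_sym sqrf_eq0.
  by move=> /eqP ->; rewrite ltxx.
have : 0 <= H (1 / 2) by apply: H_ge0; lra.
lra.
Qed.

(** [H] converges to a limit that is at least [H 1 > 0], and its boundary terms vanish at infinity.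
    The constant 20 comes from [1 - cos <= 2]. *)
Let airy_int0_cvg : exists2 a : R, 0 < a & airy_int 0 @ +oo --> a.
Proof.
have [|T T1|a Ha a1] := @cvg_of_derive_bound R H dH 20.
- by move=> T T1; apply: is_derive_H; exact: lt_le_trans T1.
- have T0 : 0 < T by exact: lt_le_trans T1.
  rewrite dH_ge0 ?(ltW T0) //= /dH.
  apply: (@le_trans _ _ (20 * T ^- 6)).
    rewrite ler_wpM2r ?invr_ge0 ?exprn_ge0 ?(ltW T0) //.
    by have := cos_geN1 (phi 0 T); lra.
  rewrite ler_wpM2l // lef_pV2 ?posrE ?exprn_gt0 //.
  exact: ler_weXn2l.
exists a; first exact: lt_le_trans a1.
have -> : airy_int 0 = (fun T => H T +
    (sin (phi 0 T) * T ^- 2 + 2 * (1 - cos (phi 0 T)) * T ^- 5)).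
  by apply/funext => T; rewrite /H; ring.
rewrite -[X in _ --> X]addr0; apply: cvgD; first exact: Ha.
rewrite -[X in _ --> X]addr0; apply: cvgD.
- apply: (@cvg0_le _ (fun T => T ^- 2)) => // T T1.
  have T0 : 0 < T by exact: lt_le_trans T1.
  rewrite normrM [`|_ ^- _|]ger0_norm ?invr_ge0 ?exprn_ge0 ?(ltW T0) //.
  by rewrite ler_piMl ?invr_ge0 ?exprn_ge0 ?(ltW T0) // sin_max.
- apply: (@cvg0_le _ (fun T => 4 * T ^- 5)) => [T T1|].
    have T0 : 0 < T by exact: lt_le_trans T1.
    rewrite normrM [`|_ ^- _|]ger0_norm ?invr_ge0 ?exprn_ge0 ?(ltW T0) //.
    rewrite ler_wpM2r ?invr_ge0 ?exprn_ge0 ?(ltW T0) //.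
    have := cos_geN1 (phi 0 T); have := cos_le1 (phi 0 T).
    by rewrite ler_norml => c1 c2; apply/andP; split; lra.
  by rewrite -[X in _ --> X](mulr0 4); apply: cvgMr; exact: inv_cvg0.
Qed.

Let F'0_cvg : exists b : R, F' 0 @ +oo --> b.
Proof.
(* One integration by parts of [t sin (t^3/3)]. The [- 1] after the cosine and the sign of [F'] make
   the derivative [dN] nonnegative. *)
pose N T := (cos (phi 0 T) - 1) * T ^- 1 - F' 0 T.
pose dN T := (1 - cos (phi 0 T)) * T ^- 2.
have [|T T1|b Hb _] := @cvg_of_derive_bound R N dN 2.
- move=> T T1; have T0 : 0 < T by exact: lt_le_trans T1.
  have Tn0 : T != 0 by rewrite gt_eqF.
  have d0 := is_derive_segment_integral (@cont_tsin 0) T0.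
  have d2 := is_derive_cos_comp (dphi_t 0 T).
  have d3 := is_derive_inv_pow 1 Tn0.
  by apply: is_derive_eq; rewrite /GRing.scale /= /dN; field.
- have T0 : 0 < T by exact: lt_le_trans T1.
  have := cos_geN1 (phi 0 T); have := cos_le1 (phi 0 T) => c1 c2.
  rewrite mulr_ge0 ?subr_ge0 ?invr_ge0 ?exprn_ge0 ?(ltW T0) //=.
  by rewrite ler_wpM2r ?invr_ge0 ?exprn_ge0 ?(ltW T0) //; lra.
exists (0 - b).
have -> : F' 0 = (fun T => (cos (phi 0 T) - 1) * T ^- 1 - N T).
  by apply/funext => T; rewrite /N; ring.
apply: cvgB; last exact: Hb.
apply: (@cvg0_le _ (fun T => 2 * T ^- 1)) => [T T1|].
  have T0 : 0 < T by exact: lt_le_trans T1.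
  rewrite normrM [`|_ ^-1|]ger0_norm ?invr_ge0 ?exprn_ge0 ?(ltW T0) //.
  rewrite ler_wpM2r ?invr_ge0 ?exprn_ge0 ?(ltW T0) //.
  have := cos_geN1 (phi 0 T); have := cos_le1 (phi 0 T).
  by rewrite ler_norml => c1 c2; apply/andP; split; lra.
by rewrite -[X in _ --> X](mulr0 2); apply: cvgMr; exact: inv_cvg0.
Qed.

Lemma airy_int_cvg : exists a b : R,
  0 < a /\ forall x, airy_int x @ +oo --> airy_sol a b x.
Proof.
have [a a0 Ha] := airy_int0_cvg; have [b Hb] := F'0_cvg.
exists a, b; split=> // x.
(* With these corrections [du/ds = v] and [dv/ds = s u + s sin (phi s T) / T^2]: the forcing
   [sin (phi s T)] of [dF'], which does not decay, cancels. *)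
pose u T s := airy_int s T - sin (phi s T) * T ^- 2 - airy_sol a b s.
pose v T s := F' s T - cos (phi s T) * T ^- 1 - airy_sol' a b s.
have sin_cvg y : (fun T => sin (phi y T) * T ^- 2) @ +oo --> (0 : R).
  apply: (@cvg0_le _ (fun T => T ^- 2)) => // T T1.
  have T0 : 0 < T by exact: lt_le_trans T1.
  rewrite normrM [`|_ ^- _|]ger0_norm ?invr_ge0 ?exprn_ge0 ?(ltW T0) //.
  by rewrite ler_piMl ?invr_ge0 ?exprn_ge0 ?(ltW T0) // sin_max.
have cos_cvg y : (fun T => cos (phi y T) * T ^- 1) @ +oo --> (0 : R).
  apply: (@cvg0_le _ (fun T => T ^- 1)) => // T T1.
  have T0 : 0 < T by exact: lt_le_trans T1.
  rewrite normrM [`|_ ^-1|]ger0_norm ?invr_ge0 ?exprn_ge0 ?(ltW T0) //.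
  by rewrite ler_piMl ?invr_ge0 ?exprn_ge0 ?(ltW T0) // cos_max.
have u0 : u ^~ 0 @ +oo --> (0 : R).
  rewrite -[X in _ --> X](subrr a) -[X in _ --> X - _]subr0.
  rewrite -[X in _ --> _ - X](airy_sol_0 a b).
  by apply: cvgB; [apply: cvgB; [exact: Ha|exact: sin_cvg]|exact: cvg_cst].
have v0 : v ^~ 0 @ +oo --> (0 : R).
  rewrite -[X in _ --> X](subrr b) -[X in _ --> X - _]subr0.
  rewrite -[X in _ --> _ - X](airy_sol'_0 a b).
  by apply: cvgB; [apply: cvgB; [exact: Hb|exact: cos_cvg]|exact: cvg_cst].
have ux : u ^~ x @ +oo --> (0 : R).
  (* The bound of [gronwall] for [q = id], with [X = |x|] and [e = |x| T^-2]; it tends to 0 because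
     [u] and [v] do at [s = 0]. *)
  pose B T := (u T 0 ^+ 2 + v T 0 ^+ 2 + (`|x| * T ^- 2) ^+ 2 * `|x|) *
      expR ((`|x| + 2) * `|x|).
  apply: (@cvg0_le _ (Num.sqrt \o B)) => [T T1|].
    have T0 : 0 < T by exact: lt_le_trans T1.
    rewrite -sqrtr_sqr ler_wsqrtr //.
    apply: (@gronwall R (u T) (v T) id (fun s => s * (sin (phi s T) * T ^- 2))) => //.
    - move=> s; have d1 := is_derive_sin_comp (dphi_x s T).
      have d2 := dF s T0; have d3 := is_derive_airy_sol a b s.
      apply: is_derive_eq; rewrite /GRing.scale /= /v.
      by field; rewrite gt_eqF.
    - move=> s; have d1 := is_derive_cos_comp (dphi_x s T).
      have d2 := dF' s T0; have d3 := is_derive_airy_sol' a b s.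
      apply: is_derive_eq; rewrite /GRing.scale /= /u.
      by field; rewrite gt_eqF.
    - move=> s sx; rewrite normrM; apply: ler_pM => //.
      rewrite normrM [`|_ ^- _|]ger0_norm ?invr_ge0 ?exprn_ge0 ?(ltW T0) //.
      by rewrite ler_piMl ?invr_ge0 ?exprn_ge0 ?(ltW T0) // sin_max.
  rewrite -[X in _ --> X](sqrtr0 R); apply: continuous_cvg; first exact: sqrt_continuous.
  rewrite -[X in _ --> X](mul0r (expR ((`|x| + 2) * `|x|))); apply: cvgMl.
  rewrite [X in _ --> X](_ : 0 = 0 * 0 + 0 * 0 + (`|x| * 0) * (`|x| * 0) * `|x|); last by ring.
  apply: cvgD; first by apply: cvgD; apply: cvgM.
  by apply: cvgMl; apply: cvgM; apply: cvgMr; exact: inv_cvg0.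
have -> : airy_int x = (fun T => u T x + sin (phi x T) * T ^- 2 + airy_sol a b x).
  by apply/funext => T; rewrite /u; ring.
rewrite -[X in _ --> X]add0r -[X in _ --> X + _](addr0 0).
by apply: cvgD; [apply: cvgD; [exact: ux|exact: sin_cvg]|exact: cvg_cst].
Qed.

End AiryIntegral.

(** * Derivatives of the Airy function *)

Section AiryEquation.
Variables (R : realType) (y y' : R -> R).
Hypothesis dy : forall x : R, is_derive x 1 y (y' x).
Hypothesis dy' : forall x : R, is_derive x 1 y' (x * y x).
Hypothesis y0 : y 0 != 0.

Let comb (v : {poly R} * {poly R}) x := v.1.[x] * y x + v.2.[x] * y' x.

Let is_derive_comb v (x : R) : is_derive x 1 (comb v) (comb (airy_deriv v) x).
Proof.
have d1 := is_derive_poly v.1 x; have d2 := is_derive_poly v.2 x.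
apply: is_derive_eq.
by rewrite /GRing.scale /= /comb /= !hornerD hornerM hornerX; ring.
Qed.

Lemma derive1n_airy n : derive1n n y = comb (airy_pair R n).
Proof.
elim: n => [|n IH].
  by apply/funext => x; rewrite /comb /= hornerC hornerC mul1r mul0r addr0.
rewrite derive1nS IH; apply/funext => x; rewrite derive1E.
by have [_] := is_derive_comb (airy_pair R n) x.
Qed.

(** Eliminating [y'] between the relation and its derivative leaves [y] times a polynomial [p]. As
    [y] has no zero near 0, [p] has infinitely many roots, and [p = 0] is the equation of
    [airy_riccati]. *)
Lemma airy_comb_eq0 v : (forall x, comb v x = 0) -> v = (0, 0).
Proof.
move=> v0.
have dv0 x : comb (airy_deriv v) x = 0.
  have [_ <-] := is_derive_comb v x.
  by rewrite (_ : comb v = cst 0) ?derive_cst //; apply/funext => z; exact: v0.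
suff : v.1 = 0 /\ v.2 = 0 by case: v {v0 dv0} => a b /= [-> ->].
apply: airy_riccati.
have : \forall x \near (0 : R), y x != 0.
  have cy : {for 0, continuous y} by exact: is_derive_continuous (dy 0).
  exact: (cvgr_neq0 _ cy y0).
move=> /nbhs_ballP [e /= e0 He].
apply/eqP; rewrite -subr_eq0; set p := (X in X == 0); apply/eqP.
have pe x : y x != 0 -> root p x.
  move=> yx; rewrite /root /p; apply/eqP; apply: (mulIf yx); rewrite mul0r.
  transitivity ((v.1 + v.2^`()).[x] * comb v x - v.2.[x] * comb (airy_deriv v) x).
    by rewrite /comb /airy_deriv /= !(hornerD, hornerN, hornerM, hornerX); ring.
  by rewrite v0 dv0 !mulr0 subr0.
(* The divisor starts at 2 to stay inside the open ball of radius [e]. *)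
apply: (@roots_geq_poly_eq0 _ _ [seq e / i.+2%:R | i <- iota 0 (size p)]).
- apply/allP => _ /mapP [i _ ->]; apply/pe/He.
  rewrite /ball /= sub0r normrN ger0_norm ?divr_ge0 ?(ltW e0) //.
  by rewrite ltr_pdivrMr // ltr_pMr // ltr1n.
- rewrite map_inj_uniq ?iota_uniq // => i j /(mulfI (lt0r_neq0 e0)) /invr_inj /eqP.
  by rewrite eqr_nat => /eqP [].
- by rewrite size_map size_iota.
Qed.

Lemma airy_comb_inj u v : (forall x, comb u x = comb v x) -> u = v.
Proof.
case: u v => [a b] [c d] uv.
have : (a - c, b - d) = (0, 0).
  apply: airy_comb_eq0 => x; have := uv x; rewrite /comb /= !hornerD !hornerN => E.
  by apply/eqP; rewrite !mulrBl addrACA -opprD subr_eq0; apply/eqP.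
by case=> /eqP + /eqP; rewrite !subr_eq0 => /eqP -> /eqP ->.
Qed.

End AiryEquation.

(** * Uniqueness of [P] and [Q], and the conclusion *)

Lemma Ai_airy_sol (R : realType) : exists a b : R,
  a != 0 /\ (@Ai R = fun x => pi^-1 * airy_sol a b x).
Proof.
have [a [b [a0 H]]] := airy_int_cvg R; exists a, b; split; first exact: lt0r_neq0.
apply/funext => x; rewrite /Ai /improper_integral; congr (_ * _).
by apply/cvg_lim => //; exact: H.
Qed.

(** Both pairs express the [n]-th derivative of [Ai] through [Ai] and its first derivative, and
    [airy_comb_inj] makes such an expression unique since [Ai 0 != 0]. *)
Lemma airy_derivative_polysE (R : realType) (P Q : nat -> {poly R}) n :
  airy_derivative_polys P Q -> airy_pair R n = (P n, Q n).
Proof.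
have [a [b [a0 AiE]]] := Ai_airy_sol R.
have dAi (x : R) : is_derive x 1 (@Ai R) (pi^-1 * airy_sol' a b x).
  rewrite AiE; have H := is_derive_airy_sol a b x.
  by apply: is_derive_eq; rewrite /GRing.scale /=; ring.
have dAi' (x : R) : is_derive x 1 (fun x => pi^-1 * airy_sol' a b x) (x * Ai x).
  rewrite AiE; have H := is_derive_airy_sol' a b x.
  by apply: is_derive_eq; rewrite /GRing.scale /=; ring.
have Ai0 : Ai (0 : R) != 0.
  by rewrite AiE airy_sol_0 mulf_neq0 // invr_neq0 // lt0r_neq0 // pi_gt0.
move=> hPQ; apply: (airy_comb_inj dAi dAi' Ai0) => x.
have [H _] := hPQ n x.
rewrite /= -[RHS]/((P n).[x] * Ai x + (Q n).[x] * (pi^-1 * airy_sol' a b x)).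
have [_ <-] := dAi x; rewrite -derive1E -H (derive1n_airy dAi dAi').
by rewrite derive1E; have [_ ->] := dAi x.
Qed.

Lemma cbrt2_cube (R : realType) : cbrt2 R ^+ 3 = 2.
Proof.
by rewrite /cbrt2 -powR_mulrn ?powR_ge0 // -powRrM mulVf ?powRr1.
Qed.

Local Close Scope classical_set_scope.

Theorem mainTheorem6 (R : realType) (P Q Pi : nat -> {poly R})
    (hPQ : airy_derivative_polys P Q) (hPi : airy_polys Pi) (n : nat) (x : R) :
  (P (2 * n)%N).[x] =
    \sum_(0 <= k < n.+1 | (2 * k <= n)%N)
      (n`!%:R * (- cbrt2 R) ^+ (n - 2 * k) / ((n - 2 * k)`!%:R * k`!%:R)) *
        (Pi (n - 2 * k)%N).[- (x / cbrt2 R)] * (P k).[x] /\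
  (Q (2 * n)%N).[x] =
    \sum_(0 <= k < n.+1 | (2 * k <= n)%N)
      (n`!%:R * (- cbrt2 R) ^+ (n - 2 * k) / ((n - 2 * k)`!%:R * k`!%:R)) *
        (Pi (n - 2 * k)%N).[- (x / cbrt2 R)] * (Q k).[x].
Proof.
have PE k : P k = (airy_pair R k).1 by rewrite (airy_derivative_polysE _ hPQ).
have QE k : Q k = (airy_pair R k).2 by rewrite (airy_derivative_polysE _ hPQ).
have [HP HQ] := airy_pair_even n x (cbrt2_cube R) (airy_poly0 hPi)
  (airy_poly1 hPi) (airy_poly2 hPi) (airy_polySSS hPi).
by split; rewrite (PE, QE) (HP, HQ); apply: eq_bigr => k _; rewrite (PE, QE).
Qed.
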